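(* Let $\epsilon>0$ and let $(\rho,\mathbf m,E,\mathbf B)$ be a smooth solution, with $\rho>0$ and $\nabla\cdot\mathbf B=0$, of the regularized MHD system $$\begin{aligned} &\partial_t\rho+\nabla\cdot\mathbf m=\epsilon\Delta\rho,\\ &\partial_t\mathbf m+\nabla\cdot(\mathbf m\otimes\mathbf u+p\,\mathbb I)-\nabla\cdot\boldsymbol\beta=\epsilon\Delta\mathbf m,\\ &\partial_tE+\nabla\cdot(\mathbf u(E+p))-\nabla\cdot(\mathbf u\cdot\boldsymbol\beta)=\epsilon\Delta E,\\ &\partial_t\mathbf B+\nabla\cdot(\mathbf u\otimes\mathbf B-\mathbf B\otimes\mathbf u)=\epsilon\Delta\mathbf B \end{aligned}$$ on $\mathbb R^d\times[0,+\infty)$. Let $f$ be a twice differentiable real function such that the generalized entropy $-\rho f(s)$ is strictly convex as a function of the conserved variables $(\rho,\mathbf m,E,\mathbf B)$. Then the solution satisfies the entropy inequality $$\partial_t(\rho f(s))+\nabla\cdot\big(\mathbf u\,\rho f(s)-\epsilon\rho\nabla f(s)-\epsilon f(s)\nabla\rho\big)\ \ge\ 0,$$ where $s=s(\rho(\mathbf x,t),e(\mathbf x,t))$.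
   Context: Here $d\ge1$ is the space dimension, $\rho,E$ are the real-valued density and total energy, and $\mathbf m,\mathbf B$ are the $\mathbb R^d$-valued momentum and magnetic field. The velocity is $\mathbf u:=\mathbf m/\rho$; $\mathbb I$ is the $d\times d$ identity; the Maxwell stress tensor is $\boldsymbol\beta:=-\tfrac12(\mathbf B\cdot\mathbf B)\mathbb I+\mathbf B\otimes\mathbf B$. Convention: for a matrix field $A$, $(\nabla\cdot A)_j=\sum_i\partial_iA_{ij}$, $(\mathbf a\otimes\mathbf b)_{ij}=a_ib_j$, $(\mathbf u\cdot\boldsymbol\beta)_j=\sum_iu_i\beta_{ij}$; the Laplacian acts componentwise. The specific internal energy $e$ is defined by $\rho e:=E-\tfrac12\rho|\mathbf u|^2-\tfrac12|\mathbf B|^2$. Thermodynamics: the specific entropy $s=s(\rho,e)$ is a smooth function of $\rho>0$ and $e$; subscripts denote partial derivatives with respect to $\rho$ and $e$. It satisfies $de=T\,ds+\frac{p}{\rho^2}d\rho$, i.e. the temperature is $T=1/s_e$ and the pressure $p$ is given by the equation of state $p\,s_e+\rho^2s_\rho=0$. Standing assumptions: $s_e>0$ (positive temperature), and $-s$ is strictly convex as a function of $(\rho^{-1},e)$, in the sense that its Hessian is positive definite; equivalently $\partial_\rho(\rho^2s_\rho)<0$, $s_{ee}<0$ and $\partial_\rho(\rho^2s_\rho)s_{ee}-\rho^2s_{\rho e}^2>0$. No assumption is made on the sign of $p$. Strict convexity of $-\rho f(s)$ means that the Hessian matrix of $-\rho f(s)$ with respect to $(\rho,\mathbf m,E,\mathbf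 B)$ is positive definite (at all states with $\rho>0$). *)

(* Defs.v *)
From HB Require Import structures.
From mathcomp Require Import all_boot all_order all_algebra.
From mathcomp Require Import all_classical all_reals all_analysis.

Set Implicit Arguments.
Unset Strict Implicit.
Unset Printing Implicit Defensive.
Import Order.TTheory GRing.Theory Num.Theory.
Import numFieldNormedType.Exports.
Local Open Scope classical_set_scope.
Local Open Scope ring_scope.

Definition dotv (R : realType) (d : nat) (a b : 'rV[R]_d) : R :=
  \sum_(i < d) a 0 i * b 0 i.

Definition tensor (R : realType) (d : nat) (a b : 'rV[R]_d) : 'M[R]_d :=
  \matrix_(i, j) (a 0 i * b 0 j).

(* Only the values on the closed half-space t >= 0 of a function of (t, x) are
   ever used: the time derivative is two-sided for t > 0 and one-sided at
   t = 0. *)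
Definition tquot (R : realType) (d : nat) (g : R -> 'rV[R]_d -> R)
    (t : R) (x : 'rV[R]_d) : R -> R :=
  fun h => h^-1 * (g (t + h) x - g t x).

Definition tincr (R : realType) (t : R) : set_system R :=
  within [set h | 0 <= t + h] 0^'.

Definition dt (R : realType) (d : nat) (g : R -> 'rV[R]_d -> R)
    (t : R) (x : 'rV[R]_d) : R :=
  lim (tquot g t x @ tincr t).

Definition dtv (R : realType) (d : nat) (v : R -> 'rV[R]_d -> 'rV[R]_d)
    (t : R) (x : 'rV[R]_d) : 'rV[R]_d :=
  \row_j dt (fun t' y => v t' y 0 j) t x.

Definition evec (R : realType) (d : nat) (i : 'I_d) : 'rV[R]_d := delta_mx 0 i.

Definition pd (R : realType) (d : nat) (i : 'I_d) (g : 'rV[R]_d -> R)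
    (x : 'rV[R]_d) : R :=
  'D_(evec R i) g x.

Definition gradient (R : realType) (d : nat) (g : 'rV[R]_d -> R)
    (x : 'rV[R]_d) : 'rV[R]_d :=
  \row_i pd i g x.

Definition divergence (R : realType) (d : nat) (v : 'rV[R]_d -> 'rV[R]_d)
    (x : 'rV[R]_d) : R :=
  \sum_(i < d) pd i (fun y => v y 0 i) x.

(* The contraction is on the first index: (div A)_j = sum_i d_i A_ij. *)
Definition divergence_mx (R : realType) (d : nat) (A : 'rV[R]_d -> 'M[R]_d)
    (x : 'rV[R]_d) : 'rV[R]_d :=
  \row_j \sum_(i < d) pd i (fun y => A y i j) x.

Definition laplacian (R : realType) (d : nat) (g : 'rV[R]_d -> R)
    (x : 'rV[R]_d) : R :=
  \sum_(i < d) pd i (pd i g) x.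

Definition laplacianv (R : realType) (d : nat) (v : 'rV[R]_d -> 'rV[R]_d)
    (x : 'rV[R]_d) : 'rV[R]_d :=
  \row_j laplacian (fun y => v y 0 j) x.

Definition hessian (R : realType) (n : nat) (F : 'rV[R]_n -> R)
    (w : 'rV[R]_n) : 'M[R]_n :=
  \matrix_(i, j) pd i (pd j F) w.

Definition posdef (R : realType) (n : nat) (H : 'M[R]_n) : Prop :=
  forall z : 'rV[R]_n, z != 0 -> 0 < (z *m H *m z^T) 0 0.

Fixpoint Ck_spacetime (R : realType) (d k : nat) (g : R -> 'rV[R]_d -> R)
    : Prop :=
  {within [set z | 0 <= z.1],
    continuous (fun z : R * 'rV[R]_d => g z.1 z.2)} /\
  if k is k'.+1 then
    [/\ forall t x, 0 <= t -> cvg (tquot g t x @ tincr t),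
        forall t x i, 0 <= t -> derivable (g t) x (evec R i),
        Ck_spacetime k' (dt g)
      & forall i, Ck_spacetime k' (fun t => pd i (g t))]
  else True.

Definition smooth_spacetime (R : realType) (d : nat)
    (g : R -> 'rV[R]_d -> R) : Prop :=
  forall k, Ck_spacetime k g.

Definition smooth_spacetimev (R : realType) (d : nat)
    (v : R -> 'rV[R]_d -> 'rV[R]_d) : Prop :=
  forall j, smooth_spacetime (fun t x => v t x 0 j).

(* Thermodynamic functions take the arguments (rho, e), in this order. *)
Definition d_rho (R : realType) (s : R -> R -> R) (r e : R) : R :=
  derive1 (fun r' => s r' e) r.

Definition d_e (R : realType) (s : R -> R -> R) (r e : R) : R :=
  derive1 (s r) e.

Fixpoint Ck_thermo (R : realType) (k : nat) (s : R -> R -> R) : Prop :=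
  {within [set z | 0 < z.1], continuous (fun z : R * R => s z.1 z.2)} /\
  if k is k'.+1 then
    [/\ forall r e, 0 < r -> derivable (fun r' => s r' e) r 1,
        forall r e, 0 < r -> derivable (s r) e 1,
        Ck_thermo k' (d_rho s)
      & Ck_thermo k' (d_e s)]
  else True.

Definition smooth_thermo (R : realType) (s : R -> R -> R) : Prop :=
  forall k, Ck_thermo k s.

Definition neg_entropy_ve (R : realType) (s : R -> R -> R) (w : 'rV[R]_2) : R :=
  - s (w 0 0)^-1 (w 0 1).

Definition velocity (R : realType) (d : nat) (rho : R) (m : 'rV[R]_d)
    : 'rV[R]_d :=
  rho^-1 *: m.

(* rho e = E - rho |u|^2 / 2 - |B|^2 / 2. *)
Definition internal_energy (R : realType) (d : nat) (rho : R) (m : 'rV[R]_d)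
    (E : R) (B : 'rV[R]_d) : R :=
  let u := velocity rho m in
  (E - 2^-1 * rho * dotv u u - 2^-1 * dotv B B) / rho.

Definition maxwell (R : realType) (d : nat) (B : 'rV[R]_d) : 'M[R]_d :=
  - (2^-1 * dotv B B)%:M + tensor B B.

(* A vector of conserved variables is the row (rho, m, E, B). *)
Definition conserved (R : realType) (d : nat) := 'rV[R]_(1 + (d + (1 + d))).

Definition cons_rho (R : realType) (d : nat) (w : conserved R d) : R :=
  lsubmx w 0 0.
Definition cons_m (R : realType) (d : nat) (w : conserved R d) : 'rV[R]_d :=
  lsubmx (rsubmx w).
Definition cons_E (R : realType) (d : nat) (w : conserved R d) : R :=
  lsubmx (rsubmx (rsubmx w)) 0 0.
Definition cons_B (R : realType) (d : nat) (w : conserved R d) : 'rV[R]_d :=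
  rsubmx (rsubmx (rsubmx w)).

Definition generalized_entropy (R : realType) (d : nat) (s : R -> R -> R)
    (f : R -> R) (w : conserved R d) : R :=
  - (cons_rho w *
     f (s (cons_rho w)
          (internal_energy (cons_rho w) (cons_m w) (cons_E w) (cons_B w)))).

Definition strictly_convex_entropy (R : realType) (d : nat) (s : R -> R -> R)
    (f : R -> R) : Prop :=
  forall w : conserved R d, 0 < cons_rho w ->
    posdef (hessian (generalized_entropy s f) w).

Definition regularized_mhd (R : realType) (d : nat) (eps : R) (p : R -> R -> R)
    (rho : R -> 'rV[R]_d -> R) (m : R -> 'rV[R]_d -> 'rV[R]_d)
    (E : R -> 'rV[R]_d -> R) (B : R -> 'rV[R]_d -> 'rV[R]_d) : Prop :=
  let u t x := velocity (rho t x) (m t x) in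
  let pr t x :=
    p (rho t x) (internal_energy (rho t x) (m t x) (E t x) (B t x)) in
  let beta t x := maxwell (B t x) in
  forall t x, 0 <= t ->
  [/\ dt rho t x + divergence (m t) x = eps * laplacian (rho t) x,
      dtv m t x
        + divergence_mx (fun y => tensor (m t y) (u t y) + (pr t y)%:M) x
        - divergence_mx (beta t) x
      = eps *: laplacianv (m t) x,
      dt E t x
        + divergence (fun y => (E t y + pr t y) *: u t y) x
        - divergence (fun y => u t y *m beta t y) x
      = eps * laplacian (E t) x
    & dtv B t x
        + divergence_mx
            (fun y => tensor (u t y) (B t y) - tensor (B t y) (u t y)) x
      = eps *: laplacianv (B t) x].

(* Main.v *)
Require Import Defs.
From HB Require Import structures.
From mathcomp Require Import all_boot all_order all_algebra.
From mathcomp Require Import all_classical all_reals all_analysis.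
From mathcomp Require Import ring lra.
Import Order.TTheory GRing.Theory Num.Theory.
Import numFieldNormedType.Exports.
Local Open Scope classical_set_scope.
Local Open Scope ring_scope.

Set Implicit Arguments.
Unset Strict Implicit.
Unset Printing Implicit Defensive.

(** Write U for the vector of conserved variables (rho, m, E, B) and eta for
    the function - rho f(s) of U, so that rho f(s) = - eta(U).  The system has
    the form d_t U + div F(U) = eps Lap U, and two facts about eta give the
    result.

    Convexity controls the diffusion.  By the chain rule,
      d_t eta(U) - eps Lap eta(U)
        = Deta(U)[d_t U - eps Lap U]
          - eps sum_i (d_i U) (Hess eta)(U) (d_i U)^T,
    and the last sum is nonnegative because the Hessian is positive definite.
    This uses that eta is Frechet differentiable with Frechet differentiable
    partial derivatives on rho > 0.  As f'' may be discontinuous, eta need not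
    be of class C^2; but f' enters the partial derivatives of eta only through
    f'(s(rho, e)), a composition of differentiable maps
    ([differentiable_pd_generalized_entropy]).  The second derivative
    along a coordinate is then computed in [is_derive_derive_comp].

    Smooth solutions of the ideal system transport the entropy.  Since
    d_t U - eps Lap U = - div F(U), the remaining term is Deta(U)[- div F(U)],
    and it has to be compared with - div(u eta(U)), that is with
    - sum_i u_i Deta(U)[d_i U] - eta(U) div u.  Everything thus depends on the
    value of Deta(U) on the vector A = sum_i u_i d_i U - div F(U).  Mass
    conservation gives that its rho component is - rho div u, and eliminating
    kinetic and magnetic energy (with div B = 0) gives the internal energy
    equation: the variation of e along A is - p div u / rho.  The equation of
    state p s_e + rho^2 s_rho = 0 says exactly that s does not vary along A, so
    Deta(U)[A] = - eta(U) div u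
    ([diff_generalized_entropy_isentropic]).

    Adding up, the left-hand side of the entropy inequality equals
    eps sum_i (d_i U) (Hess eta)(U) (d_i U)^T.

    The time derivative is one-sided at t = 0, so the chain rule is proved for
    difference quotients along an arbitrary filter finer than the punctured
    neighbourhoods of 0 ([cvg_quot_comp]); it serves for d_t as well as for the
    directional derivatives in space. *)

(** * Difference quotients and Frechet differentials *)

Lemma cvg_mx (R : realType) (T : Type) (F : set_system T) (FF : Filter F)
    (m n : nat) (M : T -> 'M[R]_(m, n)) (l : 'M[R]_(m, n)) :
  (forall i j, M x i j @[x --> F] --> l i j) -> M @ F --> l.
Proof.
move=> Ml; apply/cvgrPdist_le => /= e e0; near=> x.
rewrite /Num.Def.normr/= mx_normrE (bigmax_le _ (ltW e0))//= => i _.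
rewrite !mxE/=; move: i; near: x; apply: filter_forall => /= i.
exact: ((cvgrPdist_le _ _).1 (Ml i.1 i.2)).
Unshelve. all: by end_near. Qed.

Lemma is_diff_expand (R : realType) (V W : normedModType R) (g : V -> W)
    (a : V) : differentiable g a -> forall e, 0 < e ->
  \forall k \near (0 : V), `|g (k + a) - g a - 'd g a k| <= e * `|k|.
Proof.
move=> dg e e0; have /eqaddoP /(_ e e0) := diff_locally dg.
by apply: filterS => k /=; rewrite !fctE /= opprD addrA.
Qed.

(** Allowing any filter finer than [0^'] covers both two-sided and one-sided
    derivatives.  With q h the difference quotient of G, the quotient of g \o G
    is 'd g a (q h) plus a remainder o(h q h) / h, which vanishes because q is
    bounded along F. *)
Lemma cvg_quot_comp (R : realType) (V W : normedModType R) (g : V -> W)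
    (F : set_system R) (FF : ProperFilter F) (F0 : F --> 0^') (G : R -> V)
    (a v : V) : differentiable g a ->
  h^-1 *: (G h - a) @[h --> F] --> v ->
  h^-1 *: (g (G h) - g a) @[h --> F] --> 'd g a v.
Proof.
move=> dg Gv; set q := fun h => _ in Gv.
have hn0 : \forall h \near F, h != 0.
  by apply: (F0 [set h : R | h != 0]); exact: withinT.
have h0 : h @[h --> F] --> (0 : R).
  by apply: cvg_trans F0 _; exact: cvg_within.
have hq0 : h *: q h @[h --> F] --> (0 : V).
  by rewrite -(scale0r v); apply: cvgZ.
have dq : 'd g a (q h) @[h --> F] --> 'd g a v.
  by apply: continuous_cvg Gv; exact: diff_continuous.
rewrite -[X in _ --> X]addr0.
apply: cvg_trans (cvgD dq (_ :
  (h^-1 *: (g (h *: q h + a) - g a - 'd g a (h *: q h)) 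
    @[h --> F] --> (0 : W)))).
  apply: near_eq_cvg; near=> h; rewrite /= !fctE/=.
  have hh : h != 0 by near: h.
  rewrite /q scalerA divff// scale1r subrK linearZ/= scalerBr.
  by rewrite addrC subrK.
apply/cvgrPdist_le => /= e e0.
have [M M0 qM] : exists2 M, 0 < M & \forall h \near F, `|q h| <= M.
  exists (`|v| + 1); first by rewrite ltr_wpDl.
  move/cvgrPdist_le : Gv => /(_ 1 ltr01); apply: filterS => h /= hq.
  rewrite -[q h](subrK v) addrC (le_trans (ler_normD _ _))// lerD2l.
  by rewrite distrC.
have eM : 0 < e / M by rewrite divr_gt0.
have nearH : \forall h \near F,
    `|g (h *: q h + a) - g a - 'd g a (h *: q h)| <= e / M * `|h *: q h|.
  exact: (hq0 _ (@is_diff_expand _ _ _ _ _ dg _ eM)).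
near=> h; rewrite sub0r normrN normrZ normfV.
have hh : h != 0 by near: h.
rewrite ler_pdivrMl ?normr_gt0//.
apply: (@le_trans _ _ (e / M * `|h *: q h|)); first by near: h.
rewrite normrZ mulrCA ler_pM2l ?normr_gt0//.
rewrite mulrAC ler_pdivrMr// ler_pM2l//.
by near: h.
Unshelve. all: by end_near. Qed.

(** A criterion that avoids manipulating the differential chosen by ['d g a]:
    any continuous linear first-order approximation is the differential. *)
Lemma is_diff_intro (R : realType) (V W : normedModType R) (g : V -> W)
    (dg : {linear V -> W}) (a : V) : continuous dg ->
  (forall e, 0 < e -> \forall k \near (0 : V),
     `|g (k + a) - g a - dg k| <= e * `|k|) ->
  is_diff a g dg.
Proof.
move=> dgc gE.
have main : g \o shift a = cst (g a) + dg +o_ 0 id.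
  apply/eqaddoP => e /gE.
  by apply: filterS => k /=; rewrite !fctE /= opprD addrA.
have E : 'd g a = dg :> (V -> W) by exact: diff_unique dgc main.
by apply: DiffDef => //; apply/diff_locallyP; rewrite E.
Qed.

(** The pointwise forms below, with [fun y => a y * b y] rather than [a * b],
    let differentials of long expressions be assembled by application. *)
Section DifferentialCalculus.
Variables (R : realType) (V : normedModType R).
Implicit Types (a b da db : V -> R) (x : V).

Lemma is_diff_const (k : R) x : is_diff x (fun=> k) (fun=> 0).
Proof. exact: is_diff_cst. Qed.

Lemma is_diff_add a b da db x : is_diff x a da -> is_diff x b db ->
  is_diff x (fun y => a y + b y) (fun v => da v + db v).
Proof. exact: is_diffD. Qed.

Lemma is_diff_sub a b da db x : is_diff x a da -> is_diff x b db ->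
  is_diff x (fun y => a y - b y) (fun v => da v - db v).
Proof. exact: is_diffB. Qed.

Lemma is_diff_oppf a da x : is_diff x a da ->
  is_diff x (fun y => - a y) (fun v => - da v).
Proof. exact: is_diffN. Qed.

Lemma is_diff_mul a b da db x : is_diff x a da -> is_diff x b db ->
  is_diff x (fun y => a y * b y) (fun v => da v * b x + a x * db v).
Proof.
move=> ha hb; apply: is_diff_eq (is_diffM ha hb) _.
by apply/funext => v /=; rewrite !fctE addrC mulrC.
Qed.

Lemma is_diff_sumf n (a da : 'I_n -> V -> R) x :
  (forall i, is_diff x (a i) (da i)) ->
  is_diff x (fun y => \sum_(i < n) a i y) (fun v => \sum_(i < n) da i v).
Proof.
elim: n a da => [|n IH] a da h.
  rewrite (_ : (fun y => _) = cst 0); last by apply/funext => y; rewrite big_ord0.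
  apply: is_diff_eq (is_diff_cst 0 x) _.
  by apply/funext => v; rewrite big_ord0.
rewrite (_ : (fun y => _) = (fun y => \sum_(i < n) a (widen_ord (leqnSn n) i) y
  + a ord_max y)); last by apply/funext => y; rewrite big_ord_recr.
apply: is_diff_eq (is_diff_add (IH _ _ (fun i => h _)) (h _)) _.
by apply/funext => y; rewrite big_ord_recr.
Qed.

Lemma is_diff_compf (f : R -> R) a da x : derivable f (a x) 1 ->
  is_diff x a da -> is_diff x (fun y => f (a y)) (fun v => derive1 f (a x) * da v).
Proof.
move=> fd ha; have hf : is_diff (a x) f (fun h => h *: derive1 f (a x)).
  by apply: DiffDef; [exact/derivable1_diffP|rewrite deriv1E].
apply: is_diff_eq (is_diff_comp ha hf) _.
by apply/funext => v /=; rewrite mulrC.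
Qed.

Lemma is_diff_inv a da x : a x != 0 -> is_diff x a da ->
  is_diff x (fun y => (a y)^-1) (fun v => - (a x) ^- 2 * da v).
Proof.
move=> ax ha; apply: DiffDef; first exact: differentiableV.
by rewrite diffV//; apply/funext => v /=; rewrite diff_val.
Qed.

Lemma is_diff_near a b db x : (\forall y \near x, a y = b y) ->
  is_diff x b db -> is_diff x a db.
Proof.
move=> ab hb.
have ax : a x = b x by exact: nbhs_singleton ab.
have dbx : differentiable b x by case: hb.
rewrite -(@diff_val _ _ _ _ _ _ _ hb).
apply: is_diff_intro; first exact: diff_continuous.
move=> e /(is_diff_expand dbx).
have : \forall k \near (0 : V), a (k + x) = b (k + x).
  by move: ab; rewrite (near_shift 0) /= subr0.
by apply: filterS2 => k abk; rewrite abk ax.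
Qed.

End DifferentialCalculus.

(** * Differentiability of the thermodynamic functions *)

(** The increment g (r + h) (e + k) - g r e is cut at g r (e + k).  The first
    piece is d_rho g xi (e + k) * h by the mean value theorem, and continuity of
    d_rho g replaces xi by r; the second piece is expanded with the derivative
    in e at the base point. *)
Lemma is_diff_two_variables (R : realType) (g : R -> R -> R) (r e : R) :
  (\forall z \near (r, e), derivable (g ^~ z.2) z.1 1) ->
  derivable (g r) e 1 ->
  {for (r, e), continuous (fun z : R * R => d_rho g z.1 z.2)} ->
  is_diff (r, e) (fun z : R * R => g z.1 z.2)
    (fun v : R * R => d_rho g r e * v.1 + d_e g r e * v.2).
Proof.
move=> gr ge gc.
pose L (v : R * R) := d_rho g r e * v.1 + d_e g r e * v.2.
have Llin : linear L.
  by move=> k u v; rewrite /L /= /GRing.scale /=; ring.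
pose LM := GRing.isLinear.Build _ _ _ _ _ Llin.
pose LL : {linear (R * R)%type -> R} := HB.pack L LM.
have Lc : continuous (LL : R * R -> R).
  move=> v; apply: cvgD; apply: cvgM; try exact: cvg_cst.
    exact: cvg_fst.
  exact: cvg_snd.
apply: (@is_diff_intro _ _ _ _ LL) => // eps eps0.
have eps2 : 0 < eps / 2 by rewrite divr_gt0.
have /nbhs_ballP[d1 /= d10 hd1] := gr.
move/cvgrPdist_le : gc => /(_ _ eps2) /nbhs_ballP[d2 /= d20 hd2].
have dge : differentiable (g r) e by exact/derivable1_diffP.
have /nbhs_ballP[d3 /= d30 hd3] := is_diff_expand dge eps2.
apply/nbhs_ballP; exists (Num.min d1 (Num.min d2 d3)) => /=.
  by rewrite !lt_min d10 d20.
move=> [h k]; rewrite /ball /= /prod_ball /= => -[].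
rewrite /ball /= !sub0r !normrN !lt_min => /and3P[h1 h2 h3] /and3P[k1 k2 k3].
rewrite /L /=.
have inball d (xi : R) : `|xi - r| <= `|h| -> `|h| < d -> `|k| < d ->
    ball (r, e) d (xi, k + e).
  move=> hxi hd kd; split; rewrite /ball /=.
    by rewrite distrC (le_lt_trans hxi).
  by rewrite opprD addrCA subrr addr0 normrN.
have [xi hxi E] : exists2 xi, `|xi - r| <= `|h| &
    g (h + r) (k + e) - g r (k + e) = d_rho g xi (k + e) * h.
  have D xi : `|xi - r| <= `|h| ->
      is_derive xi 1 (g ^~ (k + e)) (d_rho g xi (k + e)).
    move=> hxi; rewrite /d_rho derive1E; apply/derivableP.
    exact: (hd1 (xi, k + e)) (inball _ _ hxi h1 k1).
  (* h may have either sign, while the mean value theorem wants a <= b. *)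
  have MV a b : a <= b -> (forall y, y \in `[a, b] -> `|y - r| <= `|h|) ->
      exists2 c, `|c - r| <= `|h| &
        g b (k + e) - g a (k + e) = d_rho g c (k + e) * (b - a).
    move=> ab hab.
    have [||c cab ->] := @MVT_segment _ (g ^~ (k + e)) (d_rho g ^~ (k + e)) _ _ ab.
    - move=> y yab; apply: D; apply: hab.
      by move: yab; rewrite !in_itv /= => /andP[/ltW-> /ltW->].
    - apply: derivable_within_continuous => y yab.
      by have [] := D y (hab _ yab).
    - by exists c => //; exact: hab.
  have [h0|h0] := leP 0 h.
    have [||c cr Ec] := MV r (h + r); first by rewrite lerDr.
      move=> y; rewrite in_itv /= => /andP[y1 y2].
      by rewrite !ger0_norm// ?subr_ge0// lerBlDr.
    by exists c => //; rewrite Ec addrK.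
  have [||c cr Ec] := MV (h + r) r; first by rewrite gerDr ltW.
    move=> y; rewrite in_itv /= => /andP[y1 y2].
    by rewrite !ler0_norm ?subr_le0 ?(ltW h0)// lerN2 lerBrDr.
  exists c => //; rewrite -opprB Ec; ring.
have A1 := hd2 (xi, k + e) (inball _ _ hxi h2 k2); rewrite /= in A1.
have : ball 0 d3 k by rewrite /ball /= sub0r normrN.
move=> /hd3 /= A2.
rewrite deriv1E// /GRing.scale /= in A2.
rewrite prod_normE /=.
have -> : g (h + r) (k + e) - g r e -
   (d_rho g r e * h + d_e g r e * k) =
   - (d_rho g r e - d_rho g xi (k + e)) * h +
   (g r (k + e) - g r e - k * d_e g r e).
  rewrite -[g (h + r) (k + e)](subrK (g r (k + e))) E; ring.
rewrite (le_trans (ler_normD _ _))// (splitr eps) mulrDl lerD//.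
  rewrite normrM normrN ler_pM// le_max lexx//.
rewrite (le_trans A2)// ler_pM2l// le_max lexx orbT//.
Qed.

Lemma is_diff_comp2 (R : realType) (V : normedModType R) (g : R -> R -> R)
    (a b da db : V -> R) (x : V) :
  is_diff (a x, b x) (fun z : R * R => g z.1 z.2)
    (fun v : R * R => d_rho g (a x) (b x) * v.1 + d_e g (a x) (b x) * v.2) ->
  is_diff x a da -> is_diff x b db ->
  is_diff x (fun y => g (a y) (b y))
    (fun v => d_rho g (a x) (b x) * da v + d_e g (a x) (b x) * db v).
Proof.
move=> hg ha hb; have hab := is_diff_pair ha hb.
exact: (@is_diff_comp _ _ _ _ _ _ (fun z : R * R => g z.1 z.2) _ _ hab hg).
Qed.

Lemma Ck_thermo_is_diff (R : realType) (g : R -> R -> R) (r e : R) :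
  Ck_thermo 1 g -> 0 < r ->
  is_diff (r, e) (fun z : R * R => g z.1 z.2)
    (fun v : R * R => d_rho g r e * v.1 + d_e g r e * v.2).
Proof.
move=> [_ [gr ge [gc _] _]] r0.
have Ho : open [set z : R * R | 0 < z.1].
  apply: (@open_comp _ _ (fun z : R * R => z.1) [set y : R | 0 < y]).
    by move=> z _; exact: cvg_fst.
  exact: open_gt.
apply: is_diff_two_variables.
- apply: filterS (open_nbhs_nbhs (conj Ho (r0 : [set z : R * R | 0 < z.1] (r, e)))).
  by move=> z z0; exact: gr.
- exact: ge.
- move: gc; rewrite continuous_open_subspace// => gc.
  by apply: gc; rewrite inE.
Qed.

Lemma smooth_thermo_is_diff (R : realType) (g : R -> R -> R) (r e : R) :
  smooth_thermo g -> 0 < r ->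
  is_diff (r, e) (fun z : R * R => g z.1 z.2)
    (fun v : R * R => d_rho g r e * v.1 + d_e g r e * v.2).
Proof. by move=> /(_ 1%N); exact: Ck_thermo_is_diff. Qed.

Lemma smooth_thermo_d_rho (R : realType) (g : R -> R -> R) :
  smooth_thermo g -> smooth_thermo (d_rho g).
Proof. by move=> g_smooth k; have [_ []] := g_smooth k.+1. Qed.

Lemma smooth_thermo_d_e (R : realType) (g : R -> R -> R) :
  smooth_thermo g -> smooth_thermo (d_e g).
Proof. by move=> g_smooth k; have [_ []] := g_smooth k.+1. Qed.

(** * The state space *)

Lemma is_diff_coord (R : realType) n (w : 'rV[R]_n) (j : 'I_n) :
  is_diff w (fun w : 'rV[R]_n => w 0 j) (fun v => v 0 j).
Proof.
have Llin : linear (fun v : 'rV[R]_n => v 0 j) by move=> k u v; rewrite !mxE.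
pose LM := GRing.isLinear.Build _ _ _ _ _ Llin.
pose LL : {linear 'rV[R]_n -> R} := HB.pack (fun v : 'rV[R]_n => v 0 j) LM.
apply: (@is_diff_intro _ _ _ _ LL); first exact: coord_continuous.
move=> e e0; near=> k; rewrite !mxE addrK subrr normr0 mulr_ge0// ltW//.
Unshelve. all: by end_near. Qed.

Section StateSpace.
Variables (R : realType) (d : nat).
Implicit Types (w v : conserved R d).

Definition state_velocity w : 'rV[R]_d := velocity (cons_rho w) (cons_m w).

Definition state_energy w : R :=
  internal_energy (cons_rho w) (cons_m w) (cons_E w) (cons_B w).

(** The differential of e: dE minus u . dm and B . dB removes the kinetic and
    magnetic parts of the variation of rho e; the coefficient of d rho collects
    1/2 |u|^2, from varying m / rho at fixed m, and - e, from dividing by rho. *)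
Definition diff_energy w v : R :=
  (cons_E v - dotv (state_velocity w) (cons_m v) - dotv (cons_B w) (cons_B v)
   + (2^-1 * dotv (state_velocity w) (state_velocity w) - state_energy w)
     * cons_rho v) / cons_rho w.

Lemma is_diff_cons_rho w : is_diff w (@cons_rho R d) (@cons_rho R d).
Proof.
have -> : @cons_rho R d = (fun w => w 0 (lshift _ 0)).
  by apply/funext => v; rewrite /cons_rho mxE.
exact: is_diff_coord.
Qed.

Lemma is_diff_cons_m w j :
  is_diff w (fun w => cons_m w 0 j) (fun w => cons_m w 0 j).
Proof.
have -> : (fun w => cons_m w 0 j) = (fun w : conserved R d => w 0 (rshift _ (lshift _ j))).
  by apply/funext => v; rewrite /cons_m !mxE.
exact: is_diff_coord.
Qed.

Lemma is_diff_cons_E w : is_diff w (@cons_E R d) (@cons_E R d).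
Proof.
have -> : @cons_E R d = (fun w => w 0 (rshift _ (rshift _ (lshift _ 0)))).
  by apply/funext => v; rewrite /cons_E !mxE.
exact: is_diff_coord.
Qed.

Lemma is_diff_cons_B w j :
  is_diff w (fun w => cons_B w 0 j) (fun w => cons_B w 0 j).
Proof.
have -> : (fun w => cons_B w 0 j) = (fun w : conserved R d => w 0 (rshift _ (rshift _ (rshift _ j)))).
  by apply/funext => v; rewrite /cons_B !mxE.
exact: is_diff_coord.
Qed.

Lemma state_velocityE w j : state_velocity w 0 j = (cons_rho w)^-1 * cons_m w 0 j.
Proof. by rewrite /state_velocity /velocity mxE. Qed.

Lemma is_diff_velocity w j : cons_rho w != 0 ->
  is_diff w (fun w => state_velocity w 0 j)
    (fun v => (cons_m v 0 j - state_velocity w 0 j * cons_rho v) / cons_rho w).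
Proof.
move=> r0; have -> : (fun w => state_velocity w 0 j) =
    (fun w => (cons_rho w)^-1 * cons_m w 0 j).
  by apply/funext => v; rewrite state_velocityE.
apply: is_diff_eq (is_diff_mul (is_diff_inv r0 (is_diff_cons_rho w)) (is_diff_cons_m w j)) _.
by apply/funext => v; rewrite state_velocityE; field.
Qed.

Lemma is_diff_energy w : cons_rho w != 0 ->
  is_diff w state_energy (diff_energy w).
Proof.
move=> r0; rewrite /state_energy /internal_energy -/(state_velocity _) /dotv.
have hu := is_diff_sumf (fun j => is_diff_mul (is_diff_velocity j r0) (is_diff_velocity j r0)).
have hB := is_diff_sumf (fun j => is_diff_mul (is_diff_cons_B w j) (is_diff_cons_B w j)).
have hr := is_diff_cons_rho w.
have hk := is_diff_mul (is_diff_sub (is_diff_sub (is_diff_cons_E w)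
  (is_diff_mul (is_diff_mul (is_diff_const 2^-1 w) hr) hu))
  (is_diff_mul (is_diff_const 2^-1 w) hB)) (is_diff_inv r0 hr).
apply: is_diff_eq hk _.
apply/funext => v /=.
(* The first sum is d |u|^2 and the second d |B|^2. *)
have -> : \sum_(i < d)
        ((cons_m v 0 i - state_velocity w 0 i * cons_rho v) / cons_rho w *
         state_velocity w 0 i +
         state_velocity w 0 i *
         ((cons_m v 0 i - state_velocity w 0 i * cons_rho v) / cons_rho w))
  = 2 * (dotv (state_velocity w) (cons_m v) - dotv (state_velocity w) (state_velocity w) * cons_rho v) / cons_rho w.
  rewrite /dotv mulr_suml -sumrB mulr_sumr mulr_suml; apply: eq_bigr => i _.
  by field.
have -> : \sum_(i < d) (cons_B v 0 i * cons_B w 0 i + cons_B w 0 i * cons_B v 0 i)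
  = 2 * dotv (cons_B w) (cons_B v).
  by rewrite /dotv mulr_sumr; apply: eq_bigr => i _; ring.
rewrite /diff_energy /state_energy /internal_energy -/(state_velocity w).
rewrite -/(dotv (state_velocity w) (state_velocity w)) -/(dotv (cons_B w) (cons_B w)).
by field.
Qed.

End StateSpace.

(** * Two derivatives of the generalized entropy *)

Section Entropy.
Variables (R : realType) (d : nat) (s : R -> R -> R) (f : R -> R).
Hypothesis s_smooth : smooth_thermo s.
Hypothesis f_derivable : forall y, derivable f y 1.
Implicit Types (w v : conserved R d).

Definition diff_entropy w v : R :=
  d_rho s (cons_rho w) (state_energy w) * cons_rho v
  + d_e s (cons_rho w) (state_energy w) * diff_energy w v.

Definition diff_generalized_entropy w v : R :=
  - (cons_rho v * f (s (cons_rho w) (state_energy w))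
     + cons_rho w * (derive1 f (s (cons_rho w) (state_energy w))
                     * diff_entropy w v)).

Lemma is_diff_thermo (g : R -> R -> R) w : smooth_thermo g -> 0 < cons_rho w ->
  is_diff w (fun w => g (cons_rho w) (state_energy w))
    (fun v => d_rho g (cons_rho w) (state_energy w) * cons_rho v
      + d_e g (cons_rho w) (state_energy w) * diff_energy w v).
Proof.
move=> g_smooth r0; apply: is_diff_comp2.
- exact: smooth_thermo_is_diff.
- exact: is_diff_cons_rho.
- by apply: is_diff_energy; rewrite gt_eqF.
Qed.

Lemma is_diff_renormalized_entropy w : 0 < cons_rho w ->
  is_diff w (fun w => f (s (cons_rho w) (state_energy w)))
    (fun v => derive1 f (s (cons_rho w) (state_energy w)) * diff_entropy w v).
Proof.
move=> r0; apply: (is_diff_compf (a := fun w => s (cons_rho w) (state_energy w))) => //.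
exact: is_diff_thermo.
Qed.

Lemma is_diff_generalized_entropy w : 0 < cons_rho w ->
  is_diff w (@generalized_entropy R d s f) (diff_generalized_entropy w).
Proof.
move=> r0; apply: is_diff_oppf; apply: is_diff_mul; first exact: is_diff_cons_rho.
exact: is_diff_renormalized_entropy.
Qed.

Lemma near_cons_rho_gt0 w : 0 < cons_rho w -> \forall y \near w, 0 < cons_rho y.
Proof.
move=> r0; have [dr _] := is_diff_cons_rho w.
have := differentiable_continuous dr => /cvgrPdist_lt /(_ _ r0).
apply: filterS => y /=; rewrite ltr_norml => /andP[_].
by rewrite ltrBlDl ltrDr.
Qed.

Lemma pd_generalized_entropy w j : 0 < cons_rho w ->
  pd j (@generalized_entropy R d s f) w
  = diff_generalized_entropy w (evec R j).
Proof.
move=> /is_diff_generalized_entropy[dg dgE].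
by rewrite /pd deriveE// dgE.
Qed.

Hypothesis f_derivable2 : forall y, derivable (derive1 f) y 1.

(** In the explicit differential, f appears as f(s) and f'(s) only, and both are
    compositions of differentiable maps.  For v = e_j this is the
    differentiability of a partial derivative of the entropy. *)
Lemma differentiable_diff_generalized_entropy w v : 0 < cons_rho w ->
  differentiable (fun y : conserved R d => diff_generalized_entropy y v) w.
Proof.
move=> r0; have rn0 : cons_rho w != 0 by rewrite gt_eqF.
have hr := is_diff_cons_rho w.
have hc (k : R) := is_diff_const k w.
have hV := is_diff_inv rn0 hr.
have he := is_diff_energy rn0.
have huv := is_diff_sumf (fun j =>
  is_diff_mul (is_diff_velocity j rn0) (hc (cons_m v 0 j))).
have huu := is_diff_sumf (fun j =>
  is_diff_mul (is_diff_velocity j rn0) (is_diff_velocity j rn0)).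
have hBv := is_diff_sumf (fun j =>
  is_diff_mul (is_diff_cons_B w j) (hc (cons_B v 0 j))).
have hde := is_diff_mul (is_diff_add
    (is_diff_sub (is_diff_sub (hc (cons_E v)) huv) hBv)
    (is_diff_mul (is_diff_sub (is_diff_mul (hc 2^-1) huu) he)
       (hc (cons_rho v)))) hV.
have hsr := is_diff_thermo (smooth_thermo_d_rho s_smooth) r0.
have hse := is_diff_thermo (smooth_thermo_d_e s_smooth) r0.
have hds := is_diff_add (is_diff_mul hsr (hc (cons_rho v)))
  (is_diff_mul hse hde).
have hf' := @is_diff_compf _ _ (derive1 f)
  (fun w => s (cons_rho w) (state_energy w)) _ w (@f_derivable2 _)
  (is_diff_thermo s_smooth r0).
have hall := is_diff_oppf (is_diff_add
  (is_diff_mul (hc (cons_rho v)) (is_diff_renormalized_entropy r0))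
  (is_diff_mul hr (is_diff_mul hf' hds))).
by case: hall.
Qed.

Lemma differentiable_pd_generalized_entropy w j : 0 < cons_rho w ->
  differentiable (pd j (@generalized_entropy R d s f)) w.
Proof.
move=> r0.
have /differentiableP h := differentiable_diff_generalized_entropy (evec R j) r0.
suff [] : is_diff w (pd j (@generalized_entropy R d s f))
  ('d (fun y : conserved R d => diff_generalized_entropy y (evec R j)) w) by [].
apply: is_diff_near h.
apply: filterS (near_cons_rho_gt0 r0) => y; exact: pd_generalized_entropy.
Qed.

End Entropy.

(** * Chain rule along a direction *)

Lemma is_derive_chain (R : realType) (V W Z : normedModType R) (g : W -> Z)
    (G : V -> W) (x v : V) (dG : W) :
  differentiable g (G x) -> is_derive x v G dG ->
  is_derive x v (fun y => g (G y)) ('d g (G x) dG).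
Proof.
move=> dg [cG <-].
have H : h^-1 *: (g (G (h *: v + x)) - g (G x)) @[h --> 0^'] --> 'd g (G x) ('D_v G x).
  exact: (@cvg_quot_comp R W Z g 0^' _ (@cvg_id _ 0^') (fun h => G (h *: v + x)) (G x) _ dg).
by apply: DeriveDef; [apply/cvg_ex; exists ('d g (G x) ('D_v G x))|exact: cvg_lim].
Qed.

Lemma differential_coords (R : realType) n (g : 'rV[R]_n -> R) (w v : 'rV[R]_n) :
  differentiable g w -> 'd g w v = \sum_(j < n) v 0 j * pd j g w.
Proof.
move=> dg; rewrite [in LHS](row_sum_delta v) linear_sum; apply: eq_bigr => j _.
by rewrite linearZ /= /pd deriveE.
Qed.

Lemma quadratic_form (R : realType) n (H : 'M[R]_n) (v : 'rV[R]_n) :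
  (v *m H *m v^T) 0 0 = \sum_(j < n) v 0 j * \sum_(k < n) v 0 k * H k j.
Proof.
rewrite mxE; apply: eq_bigr => j _; rewrite !mxE mulrC; congr (_ * _).
Qed.

Lemma is_derive_addf (R : realType) (V : normedModType R) (a b : V -> R) (x v : V)
    (da db : R) : is_derive x v a da -> is_derive x v b db ->
  is_derive x v (fun y => a y + b y) (da + db).
Proof. exact: is_deriveD. Qed.

Lemma is_derive_subf (R : realType) (V : normedModType R) (a b : V -> R) (x v : V)
    (da db : R) : is_derive x v a da -> is_derive x v b db ->
  is_derive x v (fun y => a y - b y) (da - db).
Proof. exact: is_deriveB. Qed.

Lemma is_derive_mulf (R : realType) (V : normedModType R) (a b : V -> R) (x v : V)
    (da db : R) : is_derive x v a da -> is_derive x v b db ->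
  is_derive x v (fun y => a y * b y) (da * b x + a x * db).
Proof.
move=> ha hb; apply: is_derive_eq (is_deriveM ha hb) _.
by rewrite /GRing.scale /= addrC mulrC.
Qed.

Lemma is_derive_mulc (R : realType) (V : normedModType R) (a : V -> R) (x v : V)
    (da k : R) : is_derive x v a da -> is_derive x v (fun y => a y * k) (da * k).
Proof.
move=> ha; apply: is_derive_eq (is_derive_mulf ha (is_derive_cst (k : R) x v)) _.
by rewrite mulr0 addr0.
Qed.

Lemma is_derive_sumf (R : realType) (V : normedModType R) n (a : 'I_n -> V -> R)
    (x v : V) (da : 'I_n -> R) : (forall i, is_derive x v (a i) (da i)) ->
  is_derive x v (fun y => \sum_(i < n) a i y) (\sum_(i < n) da i).
Proof.
move=> h; have := is_derive_sum h.
by congr (is_derive _ _ _ _); apply/funext => y; rewrite fct_sumE.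
Qed.

(** The first derivative of g \o U is sum_j U'_j (d_j g)(U) at every point, so
    the product rule and the chain rule for each d_j g at x give the second. *)
Lemma is_derive_derive_comp (R : realType) n (V : normedModType R)
    (g : 'rV[R]_n -> R) (U U' : V -> 'rV[R]_n) (U'' : 'rV[R]_n) (x v : V) :
  (forall y, differentiable g (U y)) ->
  (forall j, differentiable (pd j g) (U x)) ->
  (forall y, is_derive y v U (U' y)) ->
  is_derive x v U' U'' ->
  is_derive x v (fun y => 'D_v (fun z => g (U z)) y)
    ('d g (U x) U'' + (U' x *m hessian g (U x) *m (U' x)^T) 0 0).
Proof.
move=> dg d2g dU d2U.
have -> : (fun y => 'D_v (fun z => g (U z)) y) =
    (fun y => \sum_(j < n) U' y 0 j * pd j g (U y)).
  apply/funext => y; have [_ ->] := is_derive_chain (dg y) (dU y).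
  exact: differential_coords.
rewrite quadratic_form differential_coords// -big_split /=.
apply: is_derive_sumf => j.
apply: is_derive_eq.
  apply: is_derive_mulf.
    have [dc dcE] := is_diff_coord (U' x) j.
    apply: is_derive_eq (is_derive_chain dc d2U) _.
    by rewrite dcE.
  exact: is_derive_chain (d2g j) (dU x).
rewrite differential_coords//; congr (_ + _ * _).
by apply: eq_bigr => k _; rewrite mxE.
Qed.

(** * Packing and unpacking states *)

Definition state (R : realType) (d : nat) (r : R) (m : 'rV[R]_d) (E : R)
    (B : 'rV[R]_d) : conserved R d :=
  row_mx (const_mx r) (row_mx m (row_mx (const_mx E) B)).

Section State.
Variables (R : realType) (d : nat).
Implicit Types (r E : R) (m B : 'rV[R]_d).

Lemma cons_rho_state r m E B : cons_rho (state r m E B) = r.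
Proof. by rewrite /cons_rho row_mxKl mxE. Qed.

Lemma cons_m_state r m E B : cons_m (state r m E B) = m.
Proof. by rewrite /cons_m row_mxKr row_mxKl. Qed.

Lemma cons_E_state r m E B : cons_E (state r m E B) = E.
Proof. by rewrite /cons_E !row_mxKr row_mxKl mxE. Qed.

Lemma cons_B_state r m E B : cons_B (state r m E B) = B.
Proof. by rewrite /cons_B !row_mxKr. Qed.

Definition cons_stateE := (cons_rho_state, cons_m_state, cons_E_state, cons_B_state).

Lemma state_sub r m E B r' m' E' B' :
  state r m E B - state r' m' E' B' = state (r - r') (m - m') (E - E') (B - B').
Proof.
rewrite /state !opp_row_mx !add_row_mx; congr (row_mx _ (row_mx _ (row_mx _ _)));
by apply/matrixP => i j; rewrite !mxE.
Qed.

Lemma state_add r m E B r' m' E' B' :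
  state r m E B + state r' m' E' B' = state (r + r') (m + m') (E + E') (B + B').
Proof.
rewrite /state !add_row_mx; congr (row_mx _ (row_mx _ (row_mx _ _)));
by apply/matrixP => i j; rewrite !mxE.
Qed.

Lemma state_sum (I : Type) (l : seq I) (r E : I -> R) (m B : I -> 'rV[R]_d) :
  \sum_(i <- l) state (r i) (m i) (E i) (B i) =
  state (\sum_(i <- l) r i) (\sum_(i <- l) m i) (\sum_(i <- l) E i)
    (\sum_(i <- l) B i).
Proof.
elim: l => [|i l IH]; last by rewrite !big_cons IH state_add.
by have := state_sub 0 0 0 0 0 0 0 0; rewrite !big_nil !subrr.
Qed.

Lemma state_scale k r m E B :
  k *: state r m E B = state (k * r) (k *: m) (k * E) (k *: B).
Proof.
rewrite /state !scale_row_mx; congr (row_mx _ (row_mx _ (row_mx _ _)));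
by apply/matrixP => i j; rewrite !mxE.
Qed.

Lemma cvg_state (T : Type) (F : set_system T) (FF : Filter F)
    (r E : T -> R) (m B : T -> 'rV[R]_d) (r0 E0 : R) (m0 B0 : 'rV[R]_d) :
  r @ F --> r0 -> (forall j, m h 0 j @[h --> F] --> m0 0 j) ->
  E @ F --> E0 -> (forall j, B h 0 j @[h --> F] --> B0 0 j) ->
  state (r h) (m h) (E h) (B h) @[h --> F] --> state r0 m0 E0 B0.
Proof.
move=> cr cm cE cB; apply: cvg_mx => i j; rewrite ord1.
have row_state (r' E' : R) (m' B' : 'rV[R]_d) : state r' m' E' B' =
  row_mx (const_mx r') (row_mx m' (row_mx (const_mx E') B')) by [].
case: (split_ordP j) => {}j ->.
  rewrite row_state row_mxEl mxE.
  by under eq_fun do rewrite row_state row_mxEl mxE; exact: cr.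
case: (split_ordP j) => {}j ->.
  rewrite row_state row_mxEr row_mxEl.
  by under eq_fun do rewrite row_state row_mxEr row_mxEl; exact: cm.
case: (split_ordP j) => {}j ->.
  rewrite row_state !row_mxEr row_mxEl mxE.
  by under eq_fun do rewrite row_state !row_mxEr row_mxEl mxE; exact: cE.
rewrite row_state !row_mxEr.
by under eq_fun do rewrite row_state !row_mxEr; exact: cB.
Qed.

Lemma is_derive_state (V : normedModType R) (x v : V)
    (r E : V -> R) (m B : V -> 'rV[R]_d) (dr dE : R) (dm dB : 'rV[R]_d) :
  is_derive x v r dr -> (forall j, is_derive x v (fun y => m y 0 j) (dm 0 j)) ->
  is_derive x v E dE -> (forall j, is_derive x v (fun y => B y 0 j) (dB 0 j)) ->
  is_derive x v (fun y => state (r y) (m y) (E y) (B y)) (state dr dm dE dB).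
Proof.
move=> [cr er] cm [cE eE] cB.
have H : h^-1 *: (state (r (h *: v + x)) (m (h *: v + x)) (E (h *: v + x)) (B (h *: v + x))
    - state (r x) (m x) (E x) (B x)) @[h --> 0^'] --> state dr dm dE dB.
  under eq_fun do rewrite state_sub state_scale.
  apply: cvg_state.
  - by rewrite -er; exact: cr.
  - by move=> j; have [cmj <-] := cm j; under eq_fun do rewrite !mxE; exact: cmj.
  - by rewrite -eE; exact: cE.
  - by move=> j; have [cBj <-] := cB j; under eq_fun do rewrite !mxE; exact: cBj.
by apply: DeriveDef; [apply/cvg_ex; exists (state dr dm dE dB)|exact: cvg_lim].
Qed.

End State.

(** The algebra of the internal energy equation.  The letters stand for
    cu = (u . grad) u, cB = (u . grad) B, bB = (B . grad) B, bu = (B . grad) u,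
    pB = grad (|B|^2 / 2), gq = grad p, ur = u . grad rho, uE = u . grad E.
    The numerator is rho times the variation of e along
    A = sum_i u_i d_i U - div F(U): the work of the Lorentz force bB - pB and the
    stretching bu cancel against the Maxwell part of the energy flux, and only
    the compression work - p div u survives. *)
Lemma energy_balance (R : realType) n (u B cu cB bB bu pB gq : 'I_n -> R)
    (r E q ur uE divu : R) : r != 0 ->
  \sum_j u j * pB j = \sum_j B j * cB j ->
  let uu := \sum_j u j * u j in
  let BB := \sum_j B j * B j in
  (- (uE + \sum_j u j * gq j + (E + q) * divu)
    + (- (\sum_j u j * pB j) - 2^-1 * BB * divu
       + \sum_j u j * bB j + \sum_j B j * bu j) + uE
   - \sum_j u j * (- ((r * divu + ur) * u j + r * cu j + gq j)
                   + (bB j - pB j) + (r * cu j + u j * ur))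
   - \sum_j B j * (- (divu * B j + cB j - bu j) + cB j)
   + (2^-1 * uu - (E - 2^-1 * r * uu - 2^-1 * BB) / r) * - (r * divu)) / r
  = - (q * divu) / r.
Proof.
move=> r0 upB uu BB.
have -> : \sum_j u j * (- ((r * divu + ur) * u j + r * cu j + gq j)
    + (bB j - pB j) + (r * cu j + u j * ur)) =
    - (r * divu * uu) + - (\sum_j u j * gq j) + \sum_j u j * bB j + - (\sum_j u j * pB j).
  rewrite /uu mulr_sumr -!sumrN -!big_split /=.
  by apply: eq_bigr => j _; ring.
have -> : \sum_j B j * (- (divu * B j + cB j - bu j) + cB j) =
    - (divu * BB) + \sum_j B j * bu j.
  rewrite /BB mulr_sumr -!sumrN -!big_split /=.
  by apply: eq_bigr => j _; ring.
by field.
Qed.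

(** * Divergence of the ideal MHD fluxes *)

Section FluxDivergence.
Variables (R : realType) (d : nat) (x : 'rV[R]_d).
Variables (r E q : 'rV[R]_d -> R) (m B : 'rV[R]_d -> 'rV[R]_d).
Variables (gr gE gq : 'I_d -> R) (gm gB : 'I_d -> 'I_d -> R).
Hypothesis r_neq0 : r x != 0.
Hypothesis dr : forall i, is_derive x (evec R i) r (gr i).
Hypothesis dm : forall i j, is_derive x (evec R i) (fun y => m y 0 j) (gm i j).
Hypothesis dE : forall i, is_derive x (evec R i) E (gE i).
Hypothesis dB : forall i j, is_derive x (evec R i) (fun y => B y 0 j) (gB i j).
Hypothesis dq : forall i, is_derive x (evec R i) q (gq i).
Hypothesis divB : divergence B x = 0.

Let u y := velocity (r y) (m y).
Let gu i j := (gm i j - u x 0 j * gr i) / r x.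

Let dvelocity i j : is_derive x (evec R i) (fun y => u y 0 j) (gu i j).
Proof.
have hV : is_derive x (evec R i) (fun y => (r y)^-1) (- (r x) ^- 2 * gr i).
  have [cr rE] := dr i; apply: DeriveDef; first exact: derivableV.
  by rewrite deriveV// rE.
have -> : (fun y => u y 0 j) = (fun y => (r y)^-1 * m y 0 j).
  by apply/funext => y; rewrite mxE.
apply: is_derive_eq (is_derive_mulf hV (dm i j)) _.
by rewrite /gu mxE; field.
Qed.

Let divB0 : \sum_i gB i i = 0.
Proof.
rewrite -[RHS]divB; apply: eq_bigr => i _.
by rewrite /pd derive_val.
Qed.

Let gmE i j : gm i j = r x * gu i j + u x 0 j * gr i.
Proof. by rewrite /gu; field. Qed.

Let mE j : m x 0 j = r x * u x 0 j.
Proof. by rewrite /u mxE mulrA divff// mul1r. Qed.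

Let U := u x.
Let b := B x.
Let divu := \sum_i gu i i.
Let ur := \sum_i U 0 i * gr i.
Let cu j := \sum_i U 0 i * gu i j.
Let cB j := \sum_i U 0 i * gB i j.
Let bB j := \sum_i b 0 i * gB i j.
Let bu j := \sum_i b 0 i * gu i j.
Let pB j := \sum_k b 0 k * gB j k.

Lemma divergence_momentum : divergence m x = r x * divu + ur.
Proof.
rewrite /divu /ur mulr_sumr -big_split /=; apply: eq_bigr => i _.
by rewrite /pd derive_val gmE.
Qed.

Lemma divergence_momentum_flux j :
  divergence_mx (fun y => tensor (m y) (u y) + (q y)%:M) x 0 j =
  (r x * divu + ur) * U 0 j + r x * cu j + gq j.
Proof.
rewrite mxE -divergence_momentum.
have h i : is_derive x (evec R i) (fun y => (tensor (m y) (u y) + (q y)%:M) i j)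
    (gm i i * U 0 j + m x 0 i * gu i j + gq i * (i == j)%:R).
  have -> : (fun y => (tensor (m y) (u y) + (q y)%:M) i j) =
      (fun y => m y 0 i * u y 0 j + q y * (i == j)%:R).
    by apply/funext => y; rewrite !mxE mulr_natr.
  apply: is_derive_addf; first exact: is_derive_mulf.
  exact: is_derive_mulc.
under eq_bigr => i _ do rewrite /pd (@derive_val _ _ _ _ _ _ _ (h i)).
rewrite !big_split /=; congr (_ + _ + _).
- by rewrite mulr_suml; apply: eq_bigr => i _; rewrite /pd derive_val.
- by rewrite mulr_sumr; apply: eq_bigr => i _; rewrite mE mulrA.
- rewrite (bigD1 j)//= eqxx mulr1 big1 ?addr0// => i /negPf ->.
  by rewrite mulr0.
Qed.

Let dBB i : is_derive x (evec R i) (fun y => dotv (B y) (B y)) (2 * pB i).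
Proof.
apply: is_derive_eq (is_derive_sumf (fun k => is_derive_mulf (dB i k) (dB i k))) _.
by rewrite /pB mulr_sumr; apply: eq_bigr => k _; rewrite /b; ring.
Qed.

(** The term (div B) B of the Lorentz force drops out, as do its analogues in
    the energy and induction equations below. *)
Lemma divergence_maxwell j :
  divergence_mx (fun y => maxwell (B y)) x 0 j = bB j - pB j.
Proof.
rewrite mxE.
have h i : is_derive x (evec R i) (fun y => maxwell (B y) i j)
    (gB i i * b 0 j + b 0 i * gB i j - pB i * (i == j)%:R).
  have -> : (fun y => maxwell (B y) i j) =
      (fun y => B y 0 i * B y 0 j - dotv (B y) (B y) * (2^-1 * (i == j)%:R)).
    by apply/funext => y; rewrite !mxE -mulr_natr; ring.
  apply: is_derive_subf; first exact: is_derive_mulf.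
  by apply: is_derive_eq (is_derive_mulc _ (dBB i)) _; field.
under eq_bigr => i _ do rewrite /pd (@derive_val _ _ _ _ _ _ _ (h i)).
rewrite sumrB big_split /= -mulr_suml divB0 mul0r add0r; congr (_ - _).
rewrite (bigD1 j)//= eqxx mulr1 big1 ?addr0// => i /negPf ->.
by rewrite mulr0.
Qed.

Lemma divergence_energy_flux :
  divergence (fun y => (E y + q y) *: u y) x =
  \sum_i U 0 i * gE i + \sum_i U 0 i * gq i + (E x + q x) * divu.
Proof.
have h i : is_derive x (evec R i) (fun y => ((E y + q y) *: u y) 0 i)
    ((gE i + gq i) * U 0 i + (E x + q x) * gu i i).
  have -> : (fun y => ((E y + q y) *: u y) 0 i) =
      (fun y => (E y + q y) * u y 0 i) by apply/funext => y; rewrite mxE.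
  by apply: is_derive_mulf => //; exact: is_derive_addf.
rewrite /divergence; under eq_bigr => i _ do rewrite /pd (@derive_val _ _ _ _ _ _ _ (h i)).
rewrite /divu mulr_sumr -!big_split /=; apply: eq_bigr => i _; ring.
Qed.

(** Contracting first, u . beta = (u . B) B - 1/2 |B|^2 u, leaves products of
    scalar fields to differentiate. *)
Lemma divergence_stress_work :
  divergence (fun y => u y *m maxwell (B y)) x =
  - (\sum_j U 0 j * pB j) - 2^-1 * dotv b b * divu
  + \sum_j U 0 j * bB j + \sum_j b 0 j * bu j.
Proof.
have h i : is_derive x (evec R i) (fun y => (u y *m maxwell (B y)) 0 i)
    ((\sum_k (gu i k * b 0 k + U 0 k * gB i k)) * b 0 i + dotv U b * gB i i
     - (2 * pB i * (U 0 i * 2^-1) + dotv b b * (gu i i * 2^-1))).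
  have -> : (fun y => (u y *m maxwell (B y)) 0 i) =
      (fun y => dotv (u y) (B y) * B y 0 i - dotv (B y) (B y) * (u y 0 i * 2^-1)).
    apply/funext => y; rewrite mxE /dotv.
    rewrite (eq_bigr (fun k => u y 0 k * B y 0 k * B y 0 i
        - u y 0 k * (2^-1 * dotv (B y) (B y)) * (k == i)%:R)); last first.
      by move=> k _; rewrite !mxE -mulr_natr; ring.
    rewrite sumrB -mulr_suml; congr (_ - _).
    rewrite (bigD1 i)//= eqxx mulr1 big1 ?addr0; last first.
      by move=> k /negPf ->; rewrite mulr0.
    by rewrite /dotv; ring.
  apply: is_derive_subf.
    apply: is_derive_mulf => //.
    by apply: is_derive_sumf => k; exact: is_derive_mulf.
  by apply: is_derive_mulf => //; exact: is_derive_mulc.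
rewrite /divergence; under eq_bigr => i _ do rewrite /pd (@derive_val _ _ _ _ _ _ _ (h i)).
rewrite (eq_bigr (fun i => - (U 0 i * pB i) + - (2^-1 * dotv b b * gu i i)
   + \sum_k U 0 k * (b 0 i * gB i k)
   + \sum_k b 0 i * (b 0 k * gu i k) + dotv U b * gB i i)); last first.
  move=> i _; rewrite big_split /=.
  move: (dotv U b) (dotv b b) => Ub bb; rewrite mulrDl !mulr_suml.
  rewrite [X in X + _ + _ - _](eq_bigr (fun k => b 0 i * (b 0 k * gu i k))); last by move=> k _; ring.
  rewrite [X in _ + X + _ - _](eq_bigr (fun k => U 0 k * (b 0 i * gB i k))); last by move=> k _; ring.
  by field.
rewrite !big_split /= !sumrN -!mulr_sumr divB0 mulr0 addr0; congr (_ + _ + _).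
  rewrite exchange_big /=; apply: eq_bigr => k _.
  by rewrite -mulr_sumr.
rewrite exchange_big /=; apply: eq_bigr => k _.
rewrite mulr_sumr; apply: eq_bigr => i _; ring.
Qed.

Lemma divergence_induction_flux j :
  divergence_mx (fun y => tensor (u y) (B y) - tensor (B y) (u y)) x 0 j =
  divu * b 0 j + cB j - bu j.
Proof.
rewrite mxE.
have h i : is_derive x (evec R i)
    (fun y => (tensor (u y) (B y) - tensor (B y) (u y)) i j)
    (gu i i * b 0 j + U 0 i * gB i j - (gB i i * U 0 j + b 0 i * gu i j)).
  have -> : (fun y => (tensor (u y) (B y) - tensor (B y) (u y)) i j) =
      (fun y => u y 0 i * B y 0 j - B y 0 i * u y 0 j).
    by apply/funext => y; rewrite !mxE.
  by apply: is_derive_subf; exact: is_derive_mulf.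
under eq_bigr => i _ do rewrite /pd (@derive_val _ _ _ _ _ _ _ (h i)).
rewrite sumrB !big_split /= -[\sum_(i < d) gB i i * _]mulr_suml divB0 mul0r add0r.
by rewrite -[\sum_(i < d) gu i i * _]mulr_suml.
Qed.

Definition mhd_flux_divergence : conserved R d :=
  state (divergence m x)
    (divergence_mx (fun y => tensor (m y) (u y) + (q y)%:M) x
     - divergence_mx (fun y => maxwell (B y)) x)
    (divergence (fun y => (E y + q y) *: u y) x
     - divergence (fun y => u y *m maxwell (B y)) x)
    (divergence_mx (fun y => tensor (u y) (B y) - tensor (B y) (u y)) x).

Definition state_gradient i : conserved R d :=
  state (gr i) (\row_j gm i j) (gE i) (\row_j gB i j).

(** The time derivative following the flow of a solution of the ideal system:
    for such a solution - div F(U) is d_t U. *)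
Definition material_derivative : conserved R d :=
  \sum_i U 0 i *: state_gradient i - mhd_flux_divergence.

Lemma material_derivative_rho : cons_rho material_derivative = - (r x * divu).
Proof.
rewrite /material_derivative /state_gradient.
under eq_bigr do rewrite state_scale.
rewrite state_sum state_sub cons_rho_state divergence_momentum -/ur; ring.
Qed.

Lemma material_derivative_energy :
  diff_energy (state (r x) (m x) (E x) (B x)) material_derivative
  = - (q x * divu) / r x.
Proof.
have subE (a c : 'rV[R]_d) j : (a - c) 0 j = a 0 j - c 0 j by rewrite !mxE.
have scaleE k (g : 'I_d -> R) j : (k *: (\row_i g i)) 0 j = k * g j by rewrite !mxE.
have crho := material_derivative_rho.
rewrite -(@energy_balance _ _ (U 0) (b 0) cu cB bB bu pB gq (r x) (E x) (q x)
  ur (\sum_i U 0 i * gE i) divu r_neq0); last first.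
  rewrite /pB /cB; under eq_bigr do rewrite mulr_sumr.
  rewrite exchange_big; apply: eq_bigr => k _ /=; rewrite mulr_sumr.
  by apply: eq_bigr => i _; ring.
rewrite /diff_energy /state_energy /state_velocity crho !cons_stateE.
congr (_ / _); rewrite /internal_energy -/(u x) -/U -/b /dotv.
congr (_ + _ * _).
rewrite /material_derivative /state_gradient.
under eq_bigr do rewrite state_scale.
rewrite state_sum state_sub !cons_stateE.
rewrite divergence_energy_flux divergence_stress_work.
congr (_ - _ - _).
- by rewrite /dotv; ring.
- apply: eq_bigr => j _; congr (_ * _).
  rewrite !subE divergence_momentum_flux divergence_maxwell summxE.
  rewrite (eq_bigr (fun i => r x * (U 0 i * gu i j) + U 0 j * (U 0 i * gr i))).
    rewrite big_split /= -!mulr_sumr -/ur -/(cu j); ring.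
  by move=> i _; rewrite scaleE gmE -/U; ring.
- apply: eq_bigr => j _; congr (_ * _).
  rewrite subE divergence_induction_flux summxE.
  rewrite (eq_bigr (fun i => U 0 i * gB i j)) -/(cB j); first by ring.
  by move=> i _; rewrite scaleE.
Qed.

End FluxDivergence.

(** The equation of state makes the two contributions to ds cancel, so f(s) is
    constant to first order along v and only the factor rho of - rho f(s)
    varies. *)
Lemma diff_generalized_entropy_isentropic (R : realType) (d : nat)
    (s : R -> R -> R) (f : R -> R) (w v : conserved R d) (q divu : R) :
  let r := cons_rho w in let e := state_energy w in
  0 < r -> q * d_e s r e + r ^+ 2 * d_rho s r e = 0 ->
  cons_rho v = - (r * divu) -> diff_energy w v = - (q * divu) / r ->
  diff_generalized_entropy s f w v = - (generalized_entropy s f w * divu).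
Proof.
move=> r e r0 eos vr ve.
rewrite /diff_generalized_entropy /diff_entropy vr ve /generalized_entropy.
rewrite -/(state_energy w) -/r -/e.
have rn0 : r != 0 by rewrite gt_eqF.
have -> : d_rho s r e * - (r * divu) + d_e s r e * (- (q * divu) / r) =
    - (divu / r) * (q * d_e s r e + r ^+ 2 * d_rho s r e) by field.
by rewrite eos; ring.
Qed.

(** * Smooth fields and the entropy production *)

Lemma tincr_proper (R : realType) (t : R) : 0 <= t -> ProperFilter (tincr t).
Proof.
move=> t0; apply: Build_ProperFilter_ex => P; rewrite /tincr /within /=.
rewrite /dnbhs /within /= => /nbhs_ballP[e /= e0 h].
exists (e / 2); apply: h => /=.
- by rewrite /ball /= sub0r normrN ger0_norm ?divr_ge0 ?ltW// gtr_pMr// invf_lt1// ltr1n.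
- by rewrite gt_eqF// divr_gt0.
- by rewrite addr_ge0// divr_ge0// ltW.
Qed.

Lemma tincr_dnbhs (R : realType) (t : R) : tincr t --> 0^'.
Proof. exact: cvg_within. Qed.

Section Smooth.
Variables (R : realType) (d : nat) (g : R -> 'rV[R]_d -> R).
Hypothesis g_smooth : smooth_spacetime g.
Variables (t : R) (x : 'rV[R]_d).
Hypothesis t_ge0 : 0 <= t.

Lemma smooth_cvg_dt : tquot g t x @ tincr t --> dt g t x.
Proof. by have [_ [+ _ _ _]] := g_smooth 1; apply. Qed.

Lemma smooth_is_derive i : is_derive x (evec R i) (g t) (pd i (g t) x).
Proof. by apply/derivableP; have [_ [_ + _ _]] := g_smooth 1; apply. Qed.

Lemma smooth_is_derive2 i :
  is_derive x (evec R i) (pd i (g t)) (pd i (pd i (g t)) x).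
Proof.
apply/derivableP; have [_ [_ _ _ +]] := g_smooth 2 => /(_ i)[_ [_ + _ _]].
by apply.
Qed.

End Smooth.

Lemma posdef_ge0 (R : realType) n (H : 'M[R]_n) (v : 'rV[R]_n) :
  posdef H -> 0 <= (v *m H *m v^T) 0 0.
Proof.
move=> H0; have [->|/H0/ltW//] := eqVneq v 0.
by rewrite mul0mx mul0mx mxE.
Qed.

(** With A the material derivative, D = d_t U and b_i = d_i d_i U, this turns a
    regularized balance law into an identity for L(d_t U). *)
Lemma linear_split (R : realType) (V : lmodType R) (L : {linear V -> R}) n
    (A D : V) (c : 'I_n -> R) (a b : 'I_n -> V) (k : R) :
  A = \sum_i c i *: a i + (D - k *: \sum_i b i) ->
  L D = L A - \sum_i c i * L (a i) + k * \sum_i L (b i).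
Proof.
have LZ k' v : L (k' *: v) = k' * L v by rewrite linearZ.
have La : L (\sum_i c i *: a i) = \sum_i c i * L (a i).
  by rewrite linear_sum; apply: eq_bigr => i _; rewrite LZ.
have Lb : L (\sum_i b i) = \sum_i L (b i) by rewrite linear_sum.
by move=> ->; rewrite linearD linearB LZ La Lb; ring.
Qed.

Section EntropyProduction.
Variables (R : realType) (d : nat) (s p : R -> R -> R).
Hypothesis s_smooth : smooth_thermo s.
Hypothesis p_eos :
  forall r e, 0 < r -> p r e * d_e s r e + r ^+ 2 * d_rho s r e = 0.
Hypothesis temp_pos : forall r e, 0 < r -> 0 < d_e s r e.

(** The pressure is only given through the equation of state; positivity of s_e
    turns that relation into a formula, whose smoothness is visible. *)
Lemma differentiable_pressure (w : conserved R d) : 0 < cons_rho w ->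
  differentiable (fun w : conserved R d => - (cons_rho w ^+ 2
    * d_rho s (cons_rho w) (state_energy w)
    / d_e s (cons_rho w) (state_energy w))) w.
Proof.
move=> r0; have hr := is_diff_cons_rho w.
have hsr := is_diff_thermo (smooth_thermo_d_rho s_smooth) r0.
have hse := is_diff_thermo (smooth_thermo_d_e s_smooth) r0.
have se0 : d_e s (cons_rho w) (state_energy w) != 0.
  by rewrite gt_eqF// temp_pos.
have hp := is_diff_oppf (is_diff_mul (is_diff_mul (is_diff_mul hr hr) hsr)
  (is_diff_inv (a := fun w : conserved R d => d_e s (cons_rho w) (state_energy w)) se0 hse)).
by case: hp.
Qed.

Lemma pressureE r e : 0 < r -> p r e = - (r ^+ 2 * d_rho s r e / d_e s r e).
Proof.
move=> r0; have se0 : d_e s r e != 0 by rewrite gt_eqF// temp_pos.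
apply: (mulIf se0); rewrite mulNr divfK//.
by apply/eqP; rewrite -addr_eq0; apply/eqP; exact: p_eos.
Qed.

Variables (eps : R).
Variables (rho E : R -> 'rV[R]_d -> R) (m B : R -> 'rV[R]_d -> 'rV[R]_d).
Hypothesis eps_gt0 : 0 < eps.
Hypothesis rho_smooth : smooth_spacetime rho.
Hypothesis m_smooth : smooth_spacetimev m.
Hypothesis E_smooth : smooth_spacetime E.
Hypothesis B_smooth : smooth_spacetimev B.
Hypothesis rho_gt0 : forall t x, 0 <= t -> 0 < rho t x.
Hypothesis div_B : forall t x, 0 <= t -> divergence (B t) x = 0.
Hypothesis mhd : regularized_mhd eps p rho m E B.
Variable f : R -> R.
Hypothesis f_derivable : forall y, derivable f y 1.
Hypothesis f_derivable2 : forall y, derivable (derive1 f) y 1.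
Hypothesis f_convex : @strictly_convex_entropy R d s f.

Let U t x := state (rho t x) (m t x) (E t x) (B t x).
Let eta := @generalized_entropy R d s f.
Let u t x := velocity (rho t x) (m t x).
Let pr t x := p (rho t x) (internal_energy (rho t x) (m t x) (E t x) (B t x)).
Let fs t x :=
  f (s (rho t x) (internal_energy (rho t x) (m t x) (E t x) (B t x))).

Variables (t : R) (x : 'rV[R]_d).
Hypothesis t_ge0 : 0 <= t.

Let U_rho y : 0 < cons_rho (U t y).
Proof. by rewrite cons_rho_state rho_gt0. Qed.

Let stateE t' y : state_energy (U t' y)
  = internal_energy (rho t' y) (m t' y) (E t' y) (B t' y).
Proof. by rewrite /state_energy !cons_stateE. Qed.

Let dU i y := state (pd i (rho t) y) (\row_j pd i (fun z => m t z 0 j) y)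
  (pd i (E t) y) (\row_j pd i (fun z => B t z 0 j) y).

Let d2U i := state (pd i (pd i (rho t)) x)
  (\row_j pd i (pd i (fun z => m t z 0 j)) x)
  (pd i (pd i (E t)) x) (\row_j pd i (pd i (fun z => B t z 0 j)) x).

Let is_derive_U i y : is_derive y (evec R i) (U t) (dU i y).
Proof.
apply: (@is_derive_state R d _ y _ (rho t) (E t) (m t) (B t)) => [|j||j].
- exact: smooth_is_derive.
- by apply: is_derive_eq (smooth_is_derive (m_smooth j) y t_ge0 i) _; rewrite mxE.
- exact: smooth_is_derive.
- by apply: is_derive_eq (smooth_is_derive (B_smooth j) y t_ge0 i) _; rewrite mxE.
Qed.

Let is_derive_dU i : is_derive x (evec R i) (dU i) (d2U i).
Proof.
apply: (@is_derive_state R d _ x _ (pd i (rho t)) (pd i (E t))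
  (fun y => \row_j pd i (fun z => m t z 0 j) y)
  (fun y => \row_j pd i (fun z => B t z 0 j) y)) => [|j||j].
- exact: smooth_is_derive2.
- under eq_fun do rewrite mxE.
  by apply: is_derive_eq (smooth_is_derive2 (m_smooth j) x t_ge0 i) _; rewrite mxE.
- exact: smooth_is_derive2.
- under eq_fun do rewrite mxE.
  by apply: is_derive_eq (smooth_is_derive2 (B_smooth j) x t_ge0 i) _; rewrite mxE.
Qed.

Let is_derive_pr i : is_derive x (evec R i) (pr t) (pd i (pr t) x).
Proof.
apply/derivableP.
have -> : pr t = (fun y => - (cons_rho (U t y) ^+ 2
    * d_rho s (cons_rho (U t y)) (state_energy (U t y))
    / d_e s (cons_rho (U t y)) (state_energy (U t y)))).
  by apply/funext => y; rewrite -pressureE// stateE cons_rho_state.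
by have [] := is_derive_chain (differentiable_pressure (U_rho x)) (is_derive_U i x).
Qed.

Let differentiable_eta y : differentiable eta (U t y).
Proof. by have [] := is_diff_generalized_entropy s_smooth f_derivable (U_rho y). Qed.

Let etaE t' y : eta (U t' y) = - (rho t' y * fs t' y).
Proof. by rewrite /eta /generalized_entropy !cons_stateE. Qed.

Let dtU := state (dt rho t x) (dtv m t x) (dt E t x) (dtv B t x).

Lemma dt_entropy : dt (fun t' y => rho t' y * fs t' y) t x = - 'd eta (U t x) dtU.
Proof.
apply: (@cvg_lim _ _ _ (tincr t) (tincr_proper t_ge0)) => //.
have -> : tquot (fun t' y => rho t' y * fs t' y) t x =
    (fun h => - (h^-1 *: (eta (U (t + h) x) - eta (U t x)))).
  by apply/funext => h; rewrite /tquot !etaE /GRing.scale /=; ring.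
have TP := tincr_proper t_ge0.
apply: cvgN.
apply: (@cvg_quot_comp R _ _ eta (tincr t) TP (@tincr_dnbhs R t) (fun h => U (t + h) x)).
  exact: differentiable_eta.
under eq_fun do rewrite state_sub state_scale.
apply: cvg_state.
- exact: smooth_cvg_dt.
- move=> j; under eq_fun do rewrite !mxE.
  by rewrite mxE; exact: (smooth_cvg_dt (m_smooth j)).
- exact: smooth_cvg_dt.
- move=> j; under eq_fun do rewrite !mxE.
  by rewrite mxE; exact: (smooth_cvg_dt (B_smooth j)).
Qed.

Let gu i j := (pd i (fun z => m t z 0 j) x - u t x 0 j * pd i (rho t) x) / rho t x.

(** The two diffusive terms of the flux combine into eps times the gradient of
    eta(U), since rho grad f(s) + f(s) grad rho = grad (rho f(s)). *)
Lemma pd_entropy_flux i :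
  pd i (fun y => ((rho t y * fs t y) *: u t y
                  - (eps * rho t y) *: gradient (fs t) y
                  - (eps * fs t y) *: gradient (rho t) y) 0 i) x =
  - (u t x 0 i * 'd eta (U t x) (dU i x) + eta (U t x) * gu i i)
  + eps * ('d eta (U t x) (d2U i)
           + (dU i x *m hessian eta (U t x) *m (dU i x)^T) 0 0).
Proof.
have dfs y : is_derive y (evec R i) (fs t) (pd i (fs t) y).
  apply/derivableP.
  have -> : fs t = (fun y => f (s (cons_rho (U t y)) (state_energy (U t y)))).
    by apply/funext => z; rewrite stateE cons_rho_state.
  have [df _] := is_diff_renormalized_entropy s_smooth f_derivable (U_rho y).
  by have [] := is_derive_chain df (is_derive_U i y).
have dr y := smooth_is_derive rho_smooth y t_ge0 i.
have grad_eta y : 'D_(evec R i) (fun z => eta (U t z)) y =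
    - (pd i (rho t) y * fs t y + rho t y * pd i (fs t) y).
  have -> : (fun z => eta (U t z)) = (- (fun z => rho t z * fs t z)).
    by apply/funext => z; rewrite etaE.
  by have [_ ->] := is_deriveN (is_derive_mulf (dr y) (dfs y)).
have -> : (fun y => ((rho t y * fs t y) *: u t y
    - (eps * rho t y) *: gradient (fs t) y
    - (eps * fs t y) *: gradient (rho t) y) 0 i) =
  (fun y => 'D_(evec R i) (fun z => eta (U t z)) y * eps
            - eta (U t y) * u t y 0 i).
  apply/funext => y; rewrite grad_eta etaE.
  have E1 : gradient (fs t) y 0 i = pd i (fs t) y by rewrite mxE.
  have E2 : gradient (rho t) y 0 i = pd i (rho t) y by rewrite mxE.
  rewrite -E1 -E2; move: (gradient _ _) (gradient _ _) (u t y) => a b c.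
  by rewrite !mxE; ring.
have du : is_derive x (evec R i) (fun y => u t y 0 i) (gu i i).
  have [du0 du0E] := @is_diff_velocity R d (U t x) i (lt0r_neq0 (U_rho x)).
  have -> : (fun y => u t y 0 i) = (fun y => state_velocity (U t y) 0 i).
    by apply/funext => y; rewrite /state_velocity !cons_stateE.
  apply: is_derive_eq (is_derive_chain du0 (is_derive_U i x)) _.
  by rewrite du0E /state_velocity !cons_stateE mxE.
have d2 := is_derive_derive_comp differentiable_eta
  (fun j => differentiable_pd_generalized_entropy s_smooth f_derivable f_derivable2 j (U_rho x))
  (is_derive_U i) (is_derive_dU i).
have d1 := is_derive_chain (differentiable_eta x) (is_derive_U i x).
rewrite [LHS]/pd.
have [_ ->] := is_derive_subf (is_derive_mulc eps d2) (is_derive_mulf d1 du).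
have regroup (a b c k l n : R) :
    (b + c) * eps - (a * n + k * l) = - (n * a + k * l) + eps * (b + c) by ring.
exact: regroup.
Qed.

Lemma entropy_inequality :
  dt (fun t' y => rho t' y * fs t' y) t x
    + divergence (fun y => (rho t y * fs t y) *: u t y
                           - (eps * rho t y) *: gradient (fs t) y
                           - (eps * fs t y) *: gradient (rho t) y) x
    >= 0.
Proof.
pose A := material_derivative x (rho t) (E t) (pr t) (m t) (B t)
  (fun i => pd i (rho t) x) (fun i => pd i (E t) x)
  (fun i j => pd i (fun z => m t z 0 j) x)
  (fun i j => pd i (fun z => B t z 0 j) x).
(* The system itself: d_t U - eps Lap U = - div F(U). *)
have AE : A = \sum_i u t x 0 i *: dU i x + (dtU - eps *: \sum_i d2U i).
  have [mr mm mE mB] := mhd x t_ge0.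
  rewrite /A /material_derivative /mhd_flux_divergence; congr (_ + _).
  rewrite state_sum state_scale state_sub -[- state _ _ _ _]scaleN1r state_scale.
  rewrite !scaleN1r !mulN1r.
  have rows (g : R -> 'rV[R]_d -> 'rV[R]_d) :
      \sum_i (\row_j pd i (pd i (fun z => g t z 0 j)) x) = laplacianv (g t) x.
    by apply/rowP => j; rewrite summxE mxE; apply: eq_bigr => i _; rewrite mxE.
  have neg (Z : zmodType) (a b c : Z) : a + b = c -> - b = a - c.
    by move=> <-; rewrite opprD addNKr.
  have neg2 (Z : zmodType) (a b b' c : Z) : a + b - b' = c -> - (b - b') = a - c.
    by rewrite -addrA; exact: neg.
  congr state.
  - exact: (neg _ _ _ _ mr).
  - by rewrite rows; exact: (neg2 _ _ _ _ _ mm).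
  - exact: (neg2 _ _ _ _ _ mE).
  - by rewrite rows; exact: (neg _ _ _ _ mB).
have r0 : rho t x != 0 by rewrite gt_eqF// rho_gt0.
have divuE : 'd eta (U t x) A = - (eta (U t x) * \sum_i gu i i).
  have [_ ->] := is_diff_generalized_entropy s_smooth f_derivable (U_rho x).
  have dr i := smooth_is_derive rho_smooth x t_ge0 i.
  have dm i j := smooth_is_derive (m_smooth j) x t_ge0 i.
  have dE i := smooth_is_derive E_smooth x t_ge0 i.
  have dB i j := smooth_is_derive (B_smooth j) x t_ge0 i.
  have rU : cons_rho (U t x) = rho t x by exact: cons_rho_state.
  apply: (@diff_generalized_entropy_isentropic _ _ _ _ _ _ (pr t x)).
  - exact: U_rho.
  - by rewrite stateE rU; apply: p_eos; exact: rho_gt0.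
  - by rewrite rU; exact: material_derivative_rho r0 dm.
  - rewrite rU; exact: (material_derivative_energy r0 dr dm dE dB is_derive_pr (div_B x t_ge0)).
have dtE := linear_split ('d eta (U t x)) AE.
have -> : dt (fun t' y => rho t' y * fs t' y) t x
    + divergence (fun y => (rho t y * fs t y) *: u t y
                           - (eps * rho t y) *: gradient (fs t) y
                           - (eps * fs t y) *: gradient (rho t) y) x
  = eps * \sum_i (dU i x *m hessian eta (U t x) *m (dU i x)^T) 0 0.
  rewrite dt_entropy dtE divuE /divergence (eq_bigr _ (fun i _ => pd_entropy_flux i)).
  rewrite big_split /= sumrN big_split /= -!mulr_sumr big_split /=.
  move: (\sum_i u t x 0 i * _) (\sum_i gu i i) (\sum_i 'd eta (U t x) (d2U i))
    (\sum_i _) (eta (U t x)) => a b c k l.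
  by ring.
rewrite mulr_ge0 ?(ltW eps_gt0)// sumr_ge0// => i _.
by apply: posdef_ge0; apply: f_convex; exact: U_rho.
Qed.

End EntropyProduction.

Unset Implicit Arguments.

Theorem theorem4 (R : realType) (d : nat) (hd : (1 <= d)%N)
  (s p : R -> R -> R)
  (s_smooth : smooth_thermo s)
  (p_eos : forall r e, 0 < r -> p r e * d_e s r e + r ^+ 2 * d_rho s r e = 0)
  (temp_pos : forall r e, 0 < r -> 0 < d_e s r e)
  (s_convex : forall w : 'rV[R]_2, 0 < w 0 0 ->
     posdef (hessian (neg_entropy_ve s) w))
  (eps : R) (eps_gt0 : 0 < eps)
  (rho : R -> 'rV[R]_d -> R) (m : R -> 'rV[R]_d -> 'rV[R]_d)
  (E : R -> 'rV[R]_d -> R) (B : R -> 'rV[R]_d -> 'rV[R]_d)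
  (rho_smooth : smooth_spacetime rho) (m_smooth : smooth_spacetimev m)
  (E_smooth : smooth_spacetime E) (B_smooth : smooth_spacetimev B)
  (rho_gt0 : forall t x, 0 <= t -> 0 < rho t x)
  (div_B : forall t x, 0 <= t -> divergence (B t) x = 0)
  (mhd : regularized_mhd eps p rho m E B)
  (f : R -> R)
  (f_derivable : forall y, derivable f y 1)
  (f_derivable2 : forall y, derivable (derive1 f) y 1)
  (f_convex : @strictly_convex_entropy R d s f) :
  let u t x := velocity (rho t x) (m t x) in
  let fs t x :=
    f (s (rho t x) (internal_energy (rho t x) (m t x) (E t x) (B t x))) in
  forall t x, 0 <= t ->
    dt (fun t' y => rho t' y * fs t' y) t x
    + divergence (fun y => (rho t y * fs t y) *: u t y
                           - (eps * rho t y) *: gradient (fs t) y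
                           - (eps * fs t y) *: gradient (rho t) y) x
    >= 0.
Proof.
move=> u fs t x t_ge0.
exact: (entropy_inequality s_smooth p_eos temp_pos eps_gt0 rho_smooth m_smooth
  E_smooth B_smooth rho_gt0 div_B mhd f_derivable f_derivable2 f_convex x t_ge0).
Qed.
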